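(* Let $f\in C^1(\mathbb{T},(0,\infty))$ and $g\in C^2(\mathbb{T},(0,\infty))$. Let $\varepsilon,\alpha>0$, let $u^\varepsilon$ be the solution to $$u^\varepsilon_t=\frac{u^\varepsilon_{xx}}{(u^\varepsilon_x)^2+1}-\frac{n-1}{u^\varepsilon}+\frac1\varepsilon f(x)\sqrt{(u^\varepsilon_x)^2+1}\quad\text{for } x\in\mathbb{T},\ t\in(0,T^\ast_\varepsilon),\qquad u^\varepsilon(x,0)=\varepsilon^\alpha g(x)\quad\text{for } x\in\mathbb{T},$$ and let $T^\ast_\varepsilon\in(0,\infty]$ be the quenching time of this problem. Then there exists $\varepsilon_0>0$ such that for all $\varepsilon\in(0,\varepsilon_0)$: if $\alpha>1$, then $T^\ast_\varepsilon<\infty$; and if $\alpha<1$, then $T^\ast_\varepsilon=\infty$.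
   Context: $\mathbb{T}=\mathbb{R}/\mathbb{Z}$ is the one-dimensional flat torus; functions on $\mathbb{T}$ are identified with $\mathbb{Z}$-periodic functions on $\mathbb{R}$. The number $n$ is the dimension of the underlying hypersurfaces: the equation describes axisymmetric hypersurfaces $\Gamma_t=\{(x,y)\in\mathbb{R}\times\mathbb{R}^n\mid |y|=u^\varepsilon(x,t)\}\subset\mathbb{R}^{n+1}$ evolving with normal velocity $V=\kappa+\frac1\varepsilon f(x)$, where $\kappa$ is $n$ times the mean curvature. The quenching time is $T^\ast_\varepsilon:=\sup\{t>0\mid \inf_{x\in\mathbb{T}}u^\varepsilon(x,t)>0\}\in(0,\infty]$. Quenching is said to occur if $T^\ast_\varepsilon<\infty$, and not to occur if $T^\ast_\varepsilon=\infty$.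
   Formalization: The formal theorem assumes n ≥ 2: for n = 1 the term (n−1)/u vanishes and no quenching occurs, so the claim for α > 1 fails (f = g = 1, α = 2 gives u = ε² + t/ε, with infinite quenching time). *)

(* Defs.v *)
From HB Require Import structures.
From mathcomp Require Import all_boot all_order all_algebra.
From mathcomp Require Import all_classical all_reals all_analysis.

Set Implicit Arguments.
Unset Strict Implicit.
Unset Printing Implicit Defensive.

Import Order.TTheory GRing.Theory Num.Theory.
Import numFieldNormedType.Exports.

Local Open Scope classical_set_scope.
Local Open Scope ring_scope.

(* Functions on the torus R/Z are represented by 1-periodic functions on R. *)
Definition torus_class {R : realType} (k : nat) (f : R -> R) : Prop :=
  [/\ periodic f 1,
      forall i, (i < k)%N -> forall x, derivable (derive1n i f) x 1 &
      continuous (derive1n k f)].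

Section Quenching.
Context {R : realType}.
Implicit Types (u : R -> R -> R) (f : R -> R) (T : \bar R).

(* In [u x t] the first argument is space, the second is time. *)
Definition dx u (x t : R) : R := derive1 (u^~ t) x.
Definition dxx u (x t : R) : R := derive1 (dx u ^~ t) x.
Definition dt u (x t : R) : R := derive1 (u x) t.

(* T^* = sup {t > 0 | inf_x u(x,t) > 0}.  The library's [inf] is 0 on sets that
   are not bounded below, so such times are not counted. *)
Definition quenching_time u : \bar R :=
  ereal_sup [set t%:E | t in [set t : R | 0 < t /\ 0 < inf (range (u^~ t))]].

(* R x (0, T), and R x [0, T) with the initial time included. *)
Definition open_strip T : set (R * R) :=
  [set p | 0 < p.2 /\ (p.2%:E < T)%E].
Definition strip T : set (R * R) :=
  [set p | 0 <= p.2 /\ (p.2%:E < T)%E].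

Definition classical_regularity T u : Prop :=
  [/\ {within strip T, continuous (fun p : R * R => u p.1 p.2)},
      forall x t, open_strip T (x, t) ->
        [/\ derivable (u^~ t) x 1, derivable (dx u ^~ t) x 1
          & derivable (u x) t 1],
      {within open_strip T, continuous (fun p : R * R => dx u p.1 p.2)},
      {within open_strip T, continuous (fun p : R * R => dxx u p.1 p.2)} &
      {within open_strip T, continuous (fun p : R * R => dt u p.1 p.2)}].

Definition forced_flow_eq (n : nat) (eps : R) f u (x t : R) : Prop :=
  dt u x t = dxx u x t / (dx u x t ^+ 2 + 1) - (n%:R - 1) / u x t
             + eps^-1 * f x * Num.sqrt (dx u x t ^+ 2 + 1).

(* [u] is the solution issued from [u0], followed up to its quenching time.
   [u] is a total function, so its values at times past the quenching time are
   irrelevant.  The last field is what makes a finite [quenching_time u] a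
   genuine quenching time: without it one could take a solution, overwrite it by
   0 from an arbitrary time on, and produce a spurious finite supremum. *)
Record quenching_solution (n : nat) (eps : R) f (u0 : R -> R) u : Prop := {
  qs_time_gt0 : (0 < quenching_time u)%E;
  qs_periodic : forall t, periodic (u^~ t) 1;
  qs_regular : classical_regularity (quenching_time u) u;
  qs_gt0 : forall x t, strip (quenching_time u) (x, t) -> 0 < u x t;
  qs_eq : forall x t, open_strip (quenching_time u) (x, t) ->
    forced_flow_eq n eps f u x t;
  qs_init : forall x, u x 0 = u0 x;
  qs_quench : (quenching_time u < +oo)%E -> forall c : R, 0 < c ->
    exists x t, open_strip (quenching_time u) (x, t) /\ u x t < c
}.

End Quenching.

(* Main.v *)
(* At a spatial minimum (maximum) the equation gives
   u_t >= f/eps - (n-1)/u (resp. <=), so spatially constant barriers decide which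
   of the two competing terms wins: the curvature term dominates when u is well
   below eps (n-1) / max f, and the forcing when u is above eps (n-1) / min f.
   The initial datum, of order eps^alpha, lies below the first threshold when
   alpha > 1, and then u stays below a line c - eta t, which forces quenching; it
   lies above the second when alpha < 1, and then u never drops below min u0. *)
Require Import Defs.
From HB Require Import structures.
From mathcomp Require Import all_boot all_order all_algebra.
From mathcomp Require Import all_classical all_reals all_analysis.
From mathcomp Require Import ring lra.

Set Implicit Arguments.
Unset Strict Implicit.
Unset Printing Implicit Defensive.

Import Order.TTheory GRing.Theory Num.Theory.
Import numFieldNormedType.Exports.
Local Open Scope classical_set_scope.
Local Open Scope ring_scope.

(** * One-variable calculus at extrema *)

Lemma periodic1_unit_itv (R : realType) (x : R) :
  exists2 y, y \in `[0, 1] & forall f : R -> R, periodic f 1 -> f y = f x.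
Proof.
exists (x - (Num.floor x)%:~R).
  have := Num.Theory.floor_itv x; rewrite intrD => /andP[h1 h2].
  by rewrite in_itv /=; apply/andP; split; lra.
move=> f pf; case: (Num.floor x) => m.
  by rewrite -(periodicn pf m) -pmulrn subrK.
by rewrite NegzE mulrNz opprK -pmulrn (periodicn pf).
Qed.

(** The quotient form covers both sides of [x]: points to the left serve the one-sided test in time,
    points to the right the second-derivative test in space. *)
Lemma derive1_gt0_slope (R : realType) (f : R -> R) (x : R) :
  derivable f x 1 -> 0 < derive1 f x ->
  exists2 d, 0 < d & forall y, `|y - x| < d -> y != x ->
    0 < (f y - f x) / (y - x).
Proof.
move=> df; rewrite derive1E => f'_gt0.
have [d /= d0 H] : \forall h \near (0 : R), h != 0 ->
    0 < h^-1 *: (f (h *: 1 + x) - f x).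
  by have := @cvgr_gt R _ _ _ _ _ df _ f'_gt0; rewrite near_withinE; apply.
exists d => // y yd yx.
have := H (y - x).
rewrite /ball /= sub0r normrN => /(_ yd).
rewrite subr_eq0 => /(_ yx).
by rewrite /GRing.scale /= mulr1 subrK mulrC.
Qed.

(** Only earlier times are compared, because the minimum over a time slab may be attained at its
    final time. *)
Lemma left_min_derive1_le0 (R : realType) (f : R -> R) (t : R) :
  0 < t -> derivable f t 1 -> (forall s, 0 <= s <= t -> f t <= f s) ->
  derive1 f t <= 0.
Proof.
move=> t0 df fmin; rewrite leNgt; apply/negP => /(derive1_gt0_slope df)[d d0 H].
(* The cap by [t] keeps [t - e] in the range where minimality is known; the cap by [d / 2] keeps it
   where the slope is positive. *)
pose e := Num.min (d / 2) t.
have e0 : 0 < e by rewrite lt_min t0 andbT divr_gt0.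
have ed : e < d by rewrite gt_min ltr_pdivrMr// ltr_pMr// ltr1n.
have et : e <= t by rewrite ge_min lexx orbT.
have := H (t - e).
rewrite addrAC subrr add0r normrN gtr0_norm// => /(_ ed).
have -> : t - e != t by rewrite lt_eqF// ltrBlDr ltrDl.
move=> /(_ isT); rewrite invrN mulrN oppr_gt0 pmulr_llt0 ?invr_gt0//.
by rewrite subr_lt0 ltNge fmin//; apply/andP; split; lra.
Qed.

Lemma min_derive1_eq0 (R : realType) (f : R -> R) (x : R) :
  (forall y, derivable f y 1) -> (forall y, f x <= f y) -> derive1 f x = 0.
Proof.
move=> df fmin; rewrite derive1E.
have xI : x \in `]x - 1, x + 1[ by rewrite in_itv /=; apply/andP; split; lra.
have D := @derive1_at_min R f (x - 1) (x + 1) x _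
  (fun t _ => df t) xI (fun t _ => fmin t).
by apply: derive_val; apply: D; lra.
Qed.

(** The second derivative is assumed to exist only at [x], so the mean value theorem replaces a
    Taylor expansion: if it were negative, the first derivative, zero at [x], would be negative just
    to the right, and [f] would drop below its minimum. *)
Lemma min_derive1_derive1_ge0 (R : realType) (f : R -> R) (x : R) :
  (forall y, derivable f y 1) -> derivable (derive1 f) x 1 ->
  (forall y, f x <= f y) -> 0 <= derive1 (derive1 f) x.
Proof.
move=> df ddf fmin; rewrite leNgt; apply/negP => f''_lt0.
have f'x := min_derive1_eq0 df fmin.
have dNf : derivable (- derive1 f) x 1 by exact: derivableN.
have : 0 < derive1 (- derive1 f) x by rewrite derive1E deriveN// -derive1E oppr_gt0.
move=> /(derive1_gt0_slope dNf)[d d0 H].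
have cf : continuous f.
  by move=> y; apply: differentiable_continuous; exact/derivable1_diffP.
have [|||c] := @MVT R f (derive1 f) x (x + d / 2).
- by rewrite ltrDl divr_gt0.
- by move=> y _; rewrite derive1E; exact/derivableP.
- exact: continuous_subspaceT.
rewrite in_itv /= => /andP[xc cd] Hc.
have f'c : derive1 f c < 0.
  have cx : 0 < c - x by rewrite subr_gt0.
  have cd' : `|c - x| < d by rewrite gtr0_norm//; lra.
  have cNx : c != x by rewrite gt_eqF.
  have := H c cd' cNx; rewrite pmulr_lgt0 ?invr_gt0//.
  have -> : (- derive1 f) x = 0 by rewrite -oppr0 -f'x.
  by rewrite subr0 oppr_gt0.
have := fmin (x + d / 2); rewrite -subr_ge0 Hc; nra.
Qed.

(** * Extrema of periodic functions and a minimum principle *)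

Lemma periodic1_has_min (R : realType) (f : R -> R) :
  periodic f 1 -> continuous f -> exists x0, forall x, f x0 <= f x.
Proof.
move=> pf cf.
have cf01 : {within `[0, 1], continuous f} by exact: continuous_subspaceT.
have [x0 _ x0min] := EVT_min ler01 cf01.
exists x0 => x; have [y yI <-//] := periodic1_unit_itv x.
exact: x0min.
Qed.

Lemma periodic1_has_max (R : realType) (f : R -> R) :
  periodic f 1 -> continuous f -> exists x0, forall x, f x <= f x0.
Proof.
move=> pf cf; have [||x0 x0min] := @periodic1_has_min R (fun x => - f x).
- by move=> x; rewrite pf.
- by move=> x; apply: cvgN; exact: cf.
- by exists x0 => x; rewrite -lerN2.
Qed.

Lemma periodic1_has_min_slab (R : realType) (w : R -> R -> R) (t1 : R) :
  0 <= t1 -> (forall t, periodic (w^~ t) 1) ->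
  {within [set p : R * R | 0 <= p.2 <= t1],
    continuous (fun p : R * R => w p.1 p.2)} ->
  exists x0 t0, 0 <= t0 <= t1 /\
    forall x t, 0 <= t <= t1 -> w x0 t0 <= w x t.
Proof.
move=> t1_ge0 pw cw.
pose A : set (R * R) := `[0, 1]%classic `*` `[0, t1]%classic.
have AS : A `<=` [set p : R * R | 0 <= p.2 <= t1].
  by move=> p [_] /=; rewrite in_itv.
have A0 : A !=set0 by exists (0, 0); split; rewrite /= in_itv /= lexx ?ler01.
have cA : compact A by apply: compact_setX; exact: segment_compact.
have [p pA pmin] := compact_EVT_min A0 cA (continuous_subspaceW AS cw).
exists p.1, p.2; split; first by have := AS p; rewrite -in_setE => /(_ pA).
move=> x t tI; have [y yI yx] := periodic1_unit_itv x.
rewrite -(yx (w^~ t))//; apply: (pmin (y, t)).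
by rewrite inE; split => //=; rewrite in_itv.
Qed.

(* The factor e^(-Kt) turns the condition [K * w < w_t], imposed where [w < 0],
   into a contradiction with the minimality of e^(-Kt) w on the slab. *)
Lemma parabolic_min_principle (R : realType) (w : R -> R -> R) (K t1 : R) :
  0 <= t1 -> (forall t, periodic (w^~ t) 1) ->
  {within [set p : R * R | 0 <= p.2 <= t1],
    continuous (fun p : R * R => w p.1 p.2)} ->
  (forall x t, 0 < t <= t1 -> derivable (w x) t 1) ->
  (forall x, 0 <= w x 0) ->
  (forall x t, 0 < t <= t1 -> w x t < 0 -> (forall y, w x t <= w y t) ->
    K * w x t < derive1 (w x) t) ->
  forall x t, 0 <= t <= t1 -> 0 <= w x t.
Proof.
move=> t1_ge0 pw cw dw w0 Hw.
pose E t : R := expR (- K * t).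
pose W x t := E t * w x t.
have E_gt0 t : 0 < E t by exact: expR_gt0.
have dE (t : R) : is_derive t 1 E (E t * - K).
  apply: is_derive1_comp.
  apply: is_derive_eq.
  by rewrite scaler1.
have cE : continuous E.
  move=> t; apply: differentiable_continuous; exact/derivable1_diffP.
have [||x0 [t0 [t0I Wmin]]] := periodic1_has_min_slab (w := W) t1_ge0.
- by move=> t x; rewrite /W pw.
- move=> p; apply: cvgM; last exact: cw.
  apply: (continuous_subspaceT (_ : continuous (fun p : R * R => E p.2))) => q.
  by apply: (@continuous_comp _ _ _ snd E q); [exact: cvg_snd|exact: cE].
(* Since [E] is positive, [W] and [w] have the same sign, so the minimizer of [W] decides for the
   whole slab. *)
suff wmin0 : 0 <= w x0 t0.
  move=> x t tI; rewrite -(pmulr_rge0 _ (E_gt0 t)).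
  by apply: le_trans (Wmin x t tI); rewrite pmulr_rge0.
rewrite leNgt; apply/negP => wlt0.
have [t00|t00] := eqVneq t0 0; first by move: wlt0; rewrite t00 ltNge w0.
have t0p : 0 < t0 by rewrite lt0r t00; case/andP: t0I.
have t0t1 : t0 <= t1 by case/andP: t0I.
have t0I' : 0 < t0 <= t1 by rewrite t0p.
(* At the fixed time [t0] the factor [E t0] is a positive constant, so [x0] is also a spatial
   minimizer of [w], as [Hw] requires. *)
have wm y : w x0 t0 <= w y t0 by rewrite -(ler_pM2l (E_gt0 t0)); exact: Wmin.
have dwt : is_derive t0 1 (w x0) (derive1 (w x0) t0).
  by rewrite derive1E; apply/derivableP; exact: dw.
have dW : is_derive t0 1 (W x0) (E t0 * (derive1 (w x0) t0 - K * w x0 t0)).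
  have := @is_deriveM _ _ E (w x0) t0 1 _ _ (dE t0) dwt.
  move=> dEw; apply: (is_derive_eq dEw).
  by rewrite /GRing.scale /=; ring.
have : derive1 (W x0) t0 <= 0.
  apply: left_min_derive1_le0 => //.
  move=> s /andP[s0 st]; apply: Wmin; rewrite s0/=; exact: le_trans t0t1.
rewrite derive1E derive_val.
by rewrite leNgt pmulr_rgt0// subr_gt0 Hw.
Qed.

(** * Comparison of solutions with spatially constant barriers *)

Section Barriers.
Variables (R : realType) (n : nat) (eps : R) (f u0 : R -> R) (u : R -> R -> R).
Hypothesis hu : quenching_solution n eps f u0 u.
Let T := quenching_time u.

Lemma solution_derivable x t : open_strip T (x, t) ->
  [/\ forall y, derivable (u^~ t) y 1, derivable (derive1 (u^~ t)) x 1
    & derivable (u x) t 1].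
Proof.
move=> xt; have [_ + _ _ _] := qs_regular hu.
move=> H; have [? ? ?] := H _ _ xt; split=> // y.
by have [|? ? ?] := H y t.
Qed.

Lemma solution_dt_ge_at_min x t : open_strip T (x, t) ->
  (forall y, u x t <= u y t) ->
  eps^-1 * f x - (n%:R - 1) / u x t <= derive1 (u x) t.
Proof.
move=> xt umin; have [d1 d2 _] := solution_derivable xt.
have ux : dx u x t = 0 by exact: min_derive1_eq0.
have uxx : 0 <= dxx u x t by exact: min_derive1_derive1_ge0.
have := qs_eq hu xt; rewrite /forced_flow_eq /dt ux.
by rewrite expr0n /= add0r divr1 sqrtr1 mulr1 => ->; lra.
Qed.

Lemma solution_dt_le_at_max x t : open_strip T (x, t) ->
  (forall y, u y t <= u x t) ->
  derive1 (u x) t <= eps^-1 * f x - (n%:R - 1) / u x t.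
Proof.
move=> xt umax; have [d1 d2 _] := solution_derivable xt.
have d1N y : derivable (- u^~ t) y 1 by exact: derivableN.
have derN : derive1 (- u^~ t) = - derive1 (u^~ t).
  by apply/funext => y; rewrite derive1E deriveN ?derive1E -?derive1E.
have uNmin y : (- u^~ t) x <= (- u^~ t) y by rewrite !fctE lerN2.
have ux : dx u x t = 0.
  have := min_derive1_eq0 d1N uNmin.
  by rewrite derN fctE => /eqP; rewrite oppr_eq0 => /eqP.
have uxx : dxx u x t <= 0.
  have := min_derive1_derive1_ge0 d1N _ uNmin.
  rewrite derN => /(_ (derivableN d2)).
  by rewrite derive1E deriveN// oppr_ge0 -derive1E.
have := qs_eq hu xt; rewrite /forced_flow_eq /dt ux.
by rewrite expr0n /= add0r divr1 sqrtr1 mulr1 => ->; lra.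
Qed.

Lemma solution_slab_continuous t1 : (t1%:E < T)%E ->
  {within [set p : R * R | 0 <= p.2 <= t1],
    continuous (fun p : R * R => u p.1 p.2)}.
Proof.
move=> t1T; have [cu _ _ _ _] := qs_regular hu.
apply: continuous_subspaceW cu => p /= /andP[p0 p1]; split => //.
by rewrite (le_lt_trans _ t1T)// lee_fin.
Qed.

(** Away from the quenching time, [mu] keeps the singular term [(n - 1) / u] Lipschitz in [u]; this
    yields the constant [K] of the minimum principle. *)
Lemma solution_slab_lower_bound t1 : 0 <= t1 -> (t1%:E < T)%E ->
  exists2 mu, 0 < mu & forall x t, 0 <= t <= t1 -> mu <= u x t.
Proof.
move=> t1_ge0 t1T.
have [x0 [t0 [/andP[t00 t01] umin]]] := periodic1_has_min_slab t1_ge0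
  (qs_periodic hu) (solution_slab_continuous t1T).
exists (u x0 t0) => //; apply: (qs_gt0 hu); split => //=.
by rewrite (le_lt_trans _ t1T)// lee_fin.
Qed.

Hypothesis n_gt1 : (1 < n)%N.

Let n1_gt0 : 0 < n%:R - 1 :> R.
Proof. by rewrite subr_gt0 ltr1n. Qed.

Lemma solution_ge_lower_barrier (fm c : R) : 0 < eps -> 0 < c ->
  (forall x, fm <= f x) -> (n%:R - 1) / c < eps^-1 * fm ->
  (forall x, c <= u0 x) ->
  forall x t, strip T (x, t) -> c <= u x t.
Proof.
move=> eps_gt0 c_gt0 fmP cP u0P x t [/= t0 tT].
(* The slab ends at the time [t] under study: [mu] and [K] may degenerate as [t] approaches [T], but
   the bound obtained does not involve them. *)
have [mu mu_gt0 muP] := solution_slab_lower_bound t0 tT.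
rewrite -subr_ge0.
apply: (parabolic_min_principle (w := fun x t => u x t - c)
  (K := (n%:R - 1) / (c * mu)) t0) => //.
- by move=> s y; rewrite /= (qs_periodic hu).
- move=> p; apply: cvgB; last exact: cvg_cst.
  exact: solution_slab_continuous.
- move=> y s /andP[s0 st].
  have ys : open_strip T (y, s) by split => //=; exact: le_lt_trans tT.
  have [_ _ d] := solution_derivable ys.
  by apply: derivableB.
- by move=> y; rewrite subr_ge0 (qs_init hu).
- move=> y s /andP[s0 st] v_lt0 vmin.
  have ys : open_strip T (y, s) by split => //=; exact: le_lt_trans tT.
  have [_ _ d] := solution_derivable ys.
  have umin z : u y s <= u z s by have := vmin z; lra.
  have -> : derive1 (fun t => u y t - c) s = derive1 (u y) s.
    by rewrite derive1E deriveB// derive_cst subr0 -derive1E.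
  apply: lt_le_trans (solution_dt_ge_at_min ys umin).
  have u_ge : mu <= u y s by apply: muP; rewrite ltW.
  have u_gt0 : 0 < u y s by exact: lt_le_trans u_ge.
  have fy : eps^-1 * fm <= eps^-1 * f y by rewrite ler_pM2l ?invr_gt0.
  (* As [u y s - c] is negative, replacing [mu] by the larger [u y s] raises the product. The result
     is exactly the difference of the curvature terms at [c] and at [u y s], and [cP] supplies the
     strict inequality. *)
  have Ku : (n%:R - 1) / (c * mu) * (u y s - c)
      <= (n%:R - 1) / (c * u y s) * (u y s - c).
    rewrite ler_nM2r// ler_pM2l// lef_pV2 ?posrE ?mulr_gt0//.
    by rewrite ler_pM2l.
  have E : (n%:R - 1) / (c * u y s) * (u y s - c)
      = (n%:R - 1) / c - (n%:R - 1) / u y s.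
    by field; rewrite !gt_eqF.
  by rewrite E in Ku; lra.
- by rewrite t0 lexx.
Qed.

(** Where [u] exceeds the line at a spatial maximum, the hypothesis leaves a surplus of curvature
    over forcing larger than [eta], the speed at which the line descends. *)
Lemma solution_le_upper_barrier (fM c eta : R) : 0 < eps -> 0 < c ->
  0 <= eta -> (forall x, f x <= fM) ->
  eps^-1 * fM + eta < (n%:R - 1) / c ->
  (forall x, u0 x <= c) ->
  forall x t, strip T (x, t) -> u x t <= c - eta * t.
Proof.
move=> eps_gt0 c_gt0 eta_ge0 fMP cP u0P x t [/= t0 tT].
have [mu mu_gt0 muP] := solution_slab_lower_bound t0 tT.
rewrite -subr_ge0.
apply: (parabolic_min_principle (w := fun x t => c - eta * t - u x t)
  (K := (n%:R - 1) / (c * mu)) t0) => //.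
- by move=> s y; rewrite /= (qs_periodic hu).
- move=> p; apply: cvgB; last exact: solution_slab_continuous.
  apply: (continuous_subspaceT
    (_ : continuous (fun p : R * R => c - eta * p.2))) => q.
  apply: cvgB; first exact: cvg_cst.
  by apply: cvgM; [exact: cvg_cst|exact: cvg_snd].
- move=> y s /andP[s0 st].
  have ys : open_strip T (y, s) by split => //=; exact: le_lt_trans tT.
  have [_ _ d] := solution_derivable ys.
  by apply: derivableB.
- by move=> y; rewrite mulr0 subr0 subr_ge0 (qs_init hu).
- move=> y s /andP[s0 st] v_lt0 vmin.
  have ys : open_strip T (y, s) by split => //=; exact: le_lt_trans tT.
  have [_ _ d] := solution_derivable ys.
  have umax z : u z s <= u y s by have := vmin z; lra.
  have -> : derive1 (fun t => c - eta * t - u y t) s = - eta - derive1 (u y) s.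
    rewrite derive1E; apply: derive_val.
    have du : is_derive s 1 (u y) (derive1 (u y) s).
      by rewrite derive1E; exact/derivableP.
    apply: is_derive_eq.
    by rewrite /GRing.scale /=; ring.
  have Hmax := solution_dt_le_at_max ys umax.
  have u_ge : mu <= u y s by apply: muP; rewrite ltW.
  have u_gt0 : 0 < u y s by exact: lt_le_trans u_ge.
  have fy : eps^-1 * f y <= eps^-1 * fM by rewrite ler_pM2l ?invr_gt0.
  have Ku : (n%:R - 1) / (c * mu) * (c - eta * s - u y s)
      <= (n%:R - 1) / (c * u y s) * (c - eta * s - u y s).
    rewrite ler_nM2r// ler_pM2l// lef_pV2 ?posrE ?mulr_gt0//.
    by rewrite ler_pM2l.
  (* Dropping [- eta * s] reduces the moving barrier to its initial height [c], for which the
     difference of curvature terms is explicit. *)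
  have Kc : (n%:R - 1) / (c * u y s) * (c - eta * s - u y s)
      <= (n%:R - 1) / (c * u y s) * (c - u y s).
    rewrite ler_pM2l ?divr_gt0 ?mulr_gt0//.
    have : 0 <= eta * s by apply: mulr_ge0 => //; exact: ltW.
    lra.
  have E : (n%:R - 1) / (c * u y s) * (c - u y s)
      = (n%:R - 1) / u y s - (n%:R - 1) / c.
    by field; rewrite !gt_eqF.
  by rewrite E in Kc; lra.
- by rewrite t0 lexx.
Qed.

End Barriers.

(** * Choice of thresholds and conclusion *)

Lemma powR_small (R : realType) (b A : R) : 0 < b -> 0 < A ->
  exists2 e0, 0 < e0 & forall e, 0 < e -> e < e0 -> e `^ b < A.
Proof.
move=> b0 A0; exists (A `^ b^-1); first exact: powR_gt0.
move=> e e_gt0 /(gt0_ltr_powR b0); rewrite !nnegrE powR_ge0 ltW// => /(_ isT isT).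
by rewrite -powRrM mulVf ?gt_eqF// powRr1// ltW.
Qed.

Theorem proposition1p1 (R : realType) (n : nat) (hn : (2 <= n)%N)
    (f g : R -> R)
    (hf : torus_class 1 f) (f_gt0 : forall x, 0 < f x)
    (hg : torus_class 2 g) (g_gt0 : forall x, 0 < g x)
    (alpha : R) (halpha : 0 < alpha) :
  exists eps0 : R, 0 < eps0 /\
    forall eps : R, 0 < eps -> eps < eps0 ->
    forall u : R -> R -> R,
      quenching_solution n eps f (fun x => eps `^ alpha * g x) u ->
      (1 < alpha -> (quenching_time u < +oo)%E) /\
      (alpha < 1 -> quenching_time u = +oo%E).
Proof.
have [pf df _] := hf; have [pg dg _] := hg.
have cf : continuous f.
  by move=> x; apply/differentiable_continuous/derivable1_diffP/(df 0).
have cg : continuous g.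
  by move=> x; apply/differentiable_continuous/derivable1_diffP/(dg 0).
have n1_gt0 : 0 < n%:R - 1 :> R by rewrite subr_gt0 ltr1n.
have [alpha_lt1|alpha_gt1|->] := ltgtP alpha 1; last first.
- by exists 1; split => // eps _ _ u _; split; rewrite ltxx.
- have [xf fM] := periodic1_has_max pf cf.
  have [xg gM] := periodic1_has_max pg cg.
  have b_gt0 : 0 < alpha - 1 by rewrite subr_gt0.
  have A_gt0 : 0 < (n%:R - 1) / (3 * f xf * g xg).
    by rewrite divr_gt0 ?mulr_gt0.
  have [eps0 eps0_gt0 eps0P] := powR_small b_gt0 A_gt0.
  exists eps0; split => // eps eps_gt0 eps_lt u hu; split => // _.
  rewrite ltNge leye_eq; apply/negP => /eqP TE.
  (* The factor 3 makes the curvature term at [c] equal to [3 * eta]: one [eta] balances the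
     forcing, one drives the descent, and one gives strictness. *)
  pose c := eps * (n%:R - 1) / (3 * f xf).
  pose eta := eps^-1 * f xf.
  have c_gt0 : 0 < c by rewrite divr_gt0 ?mulr_gt0.
  have eta_gt0 : 0 < eta by rewrite mulr_gt0 ?invr_gt0.
  have barrier : forall x t, strip (quenching_time u) (x, t) ->
      u x t <= c - eta * t.
    apply: (solution_le_upper_barrier hu hn (fM := f xf)) => //.
    + exact: ltW.
    + have -> : (n%:R - 1) / c = 3 * eta.
        by rewrite /c /eta; field; rewrite !gt_eqF.
      by rewrite -/eta; lra.
    + move=> x; have := eps0P _ eps_gt0 eps_lt.
      have -> : eps `^ alpha = eps * eps `^ (alpha - 1).
        rewrite -{2}(powRr1 (ltW eps_gt0)) -powRD ?subrKC//.
        by rewrite gt_eqF ?implybT.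
      move=> small.
      apply: (@le_trans _ _ (eps * eps `^ (alpha - 1) * g xg)).
        by rewrite ler_pM2l ?mulr_gt0 ?powR_gt0.
      have -> : c = eps * ((n%:R - 1) / (3 * f xf * g xg)) * g xg.
        by rewrite /c; field; rewrite !gt_eqF.
      by rewrite ler_pM2r// ler_pM2l// ltW.
  (* At time [c / eta] the descending line reaches zero, whereas a solution with infinite quenching
     time is still positive there. *)
  have xt : strip (quenching_time u) (0, c / eta).
    by split; rewrite /= ?TE ?ltry// divr_ge0// ltW.
  have := barrier _ _ xt; rewrite [eta * _]mulrC divfK ?gt_eqF// subrr.
  by rewrite leNgt (qs_gt0 hu).
- have [xf fm] := periodic1_has_min pf cf.
  have [xg gm] := periodic1_has_min pg cg.
  have b_gt0 : 0 < 1 - alpha by rewrite subr_gt0.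
  have A_gt0 : 0 < f xf * g xg / (n%:R - 1) by rewrite divr_gt0 ?mulr_gt0.
  have [eps0 eps0_gt0 eps0P] := powR_small b_gt0 A_gt0.
  exists eps0; split => // eps eps_gt0 eps_lt u hu; split => // _.
  apply/eqP; rewrite -leye_eq leNgt; apply/negP => Tfin.
  pose c := eps `^ alpha * g xg.
  have c_gt0 : 0 < c by rewrite mulr_gt0 ?powR_gt0.
  have barrier : forall x t, strip (quenching_time u) (x, t) -> c <= u x t.
    apply: (solution_ge_lower_barrier hu hn (fm := f xf)) => //.
    + have := eps0P _ eps_gt0 eps_lt.
      rewrite ltr_pdivlMr// => small.
      have epsE : eps `^ alpha * eps `^ (1 - alpha) = eps.
        rewrite -powRD ?subrKC ?powRr1 ?ltW//.
        by rewrite gt_eqF ?implybT.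
      rewrite ltr_pdivrMr// -mulrA ltr_pdivlMl// -[X in X * _]epsE.
      by rewrite /c mulrCA -mulrA ltr_pM2l ?powR_gt0.
    + by move=> x; rewrite ler_pM2l ?powR_gt0.
  (* A finite quenching time would force values of [u] below [c], against the barrier. *)
  have [x [t [[/= t_gt0 tT]]]] := qs_quench hu Tfin c_gt0.
  by rewrite ltNge barrier//; split => //=; exact: ltW.
Qed.
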